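(* Let $T$ be a tournament. Then $\gamma_{so}(T)\le\gamma^+(T)+1$.
   Context: A tournament is an orientation of a complete graph. For a digraph $D=(V,A)$, $N^+(v)=\{w: vw\in A\}$, $N^-(v)=\{w: wv\in A\}$. $S\subseteq V$ is out-dominating if every $v\in V\setminus S$ has an in-neighbor in $S$; $\gamma^+(D)$ is the minimum size of an out-dominating set. $S$ is a secure out-dominating set (SODS) if $S$ is out-dominating and for every $v\in V\setminus S$ there is $u\in(N^+(v)\cup N^-(v))\cap S$ such that $(S\setminus\{u\})\cup\{v\}$ is out-dominating; $\gamma_{so}(D)$ is the minimum size of an SODS. *)

(* Defs.v *)
From mathcomp Require Import all_boot.

Set Implicit Arguments.
Unset Strict Implicit.
Unset Printing Implicit Defensive.

(* A digraph on the finite vertex set V is given by its arc relation D :      *)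
(* D v w means that vw is an arc.                                             *)

Definition tournament (V : finType) (D : rel V) : Prop :=
  irreflexive D /\ forall v w : V, v != w -> D v w (+) D w v.

Definition out_nbrs (V : finType) (D : rel V) (v : V) : {set V} :=
  [set w | D v w].

Definition in_nbrs (V : finType) (D : rel V) (v : V) : {set V} :=
  [set w | D w v].

Definition out_dominating (V : finType) (D : rel V) (S : {set V}) : bool :=
  [forall v in ~: S, exists u in in_nbrs D v, u \in S].

Definition secure_out_dominating (V : finType) (D : rel V) (S : {set V})
    : bool :=
  out_dominating D S &&
  [forall v in ~: S,
    exists u in (out_nbrs D v :|: in_nbrs D v) :&: S,
      out_dominating D (v |: (S :\ u))].

(* The full vertex set satisfies both predicates vacuously (out_dominatingT   *)
(* and secure_out_dominatingT below), so the two minima are attained.         *)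

Definition out_domination_number (V : finType) (D : rel V) : nat :=
  #|[arg min_(S < [set: V] | out_dominating D S) #|S| ]|.

Definition secure_out_domination_number (V : finType) (D : rel V) : nat :=
  #|[arg min_(S < [set: V] | secure_out_dominating D S) #|S| ]|.

Lemma out_dominatingT (V : finType) (D : rel V) : out_dominating D [set: V].
Proof. by apply/forall_inP => v; rewrite !inE. Qed.

Lemma secure_out_dominatingT (V : finType) (D : rel V) :
  secure_out_dominating D [set: V].
Proof.
by rewrite /secure_out_dominating out_dominatingT; apply/forall_inP => v;
  rewrite !inE.
Qed.

(* Main.v *)
(** If S is a minimum out-dominating set and x lies outside S, then x |: S is
    secure: any other vertex v is adjacent to x, and swapping x for v yields
    v |: S, which still contains S. If there is no such x, then S is the whole
    vertex set and is vacuously secure. *)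
Require Import Defs.
From mathcomp Require Import all_boot.

Lemma out_dominating_superset (V : finType) (D : rel V) (A B : {set V}) :
  A \subset B -> out_dominating D A -> out_dominating D B.
Proof.
move=> /subsetP sAB /forall_inP domA; apply/forall_inP => v.
rewrite inE => vNB; have vNA : v \in ~: A by rewrite inE (contra (sAB v)).
have /exists_inP[u uv uA] := domA v vNA.
by apply/exists_inP; exists u => //; apply: sAB.
Qed.

Lemma secure_out_dominating_setU1 (V : finType) (D : rel V) (S : {set V})
    (x : V) :
  tournament D -> out_dominating D S -> x \notin S ->
  secure_out_dominating D (x |: S).
Proof.
move=> [_ tourD] domS xNS; apply/andP; split.
  exact: out_dominating_superset (subsetUr _ _) domS.
apply/forall_inP => v; rewrite !inE negb_or => /andP[vx _].
apply/exists_inP; exists x; last first.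
  (* Since [x \notin S], deleting [x] from [x |: S] restores exactly [S], so the swapped set is
     [v |: S]. *)
  rewrite setU1K //; exact: out_dominating_superset (subsetUr _ _) domS.
(* One of the two arcs between [v] and [x] is present, and either one makes [x] a neighbor of
   [v]. *)
by rewrite !inE eqxx andbT; have := tourD v x vx; case: (D v x).
Qed.

Lemma secure_out_domination_number_le (V : finType) (D : rel V) (S : {set V}) :
  secure_out_dominating D S -> secure_out_domination_number D <= #|S|.
Proof.
rewrite /secure_out_domination_number.
by case: arg_minnP => [|A _ minA /minA //]; apply: secure_out_dominatingT.
Qed.

Theorem theorem4p11 (V : finType) (T : rel V) (hT : tournament T) :
  secure_out_domination_number T <= out_domination_number T + 1.
Proof.
rewrite /out_domination_number.
case: arg_minnP => [|S domS _]; first exact: out_dominatingT.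
have [->|] := eqVneq S [set: V].
  (* The [+ 1] is slack here: [[set: V]] is itself secure, with no vertex added. *)
  apply: leq_trans (leq_addr _ _).
  exact/secure_out_domination_number_le/secure_out_dominatingT.
rewrite -subTset => /subsetPn[x _ xNS].
have := secure_out_dominating_setU1 V T S x hT domS xNS.
by move/secure_out_domination_number_le; rewrite cardsU1 xNS addnC.
Qed.
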